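(* If $0\le p\le1$ and $n\ge1$, then $\widehat T_{n,p}\overset{\mathrm d}{=}T_{n;X,0}$ (equality in distribution of random graphs with vertex set $[n]$), where $X$ is a random variable having density $1-p$ on $(-1,0)$ and $p$ on $(0,1)$.
   Context: $[n]=\{1,\dots,n\}$. For $p\in[0,1]$, $T_{n,p}$ is the random threshold graph on $n$ vertices obtained by starting with a single vertex and adding vertices one by one ($n-1$ additions), each new vertex being, independently of the others, dominating (joined to all previous vertices) with probability $p$ and isolated (joined to no previous vertex) with probability $1-p$. $\widehat T_{n,p}$ is the random graph on $[n]$ obtained by a uniformly random permutation of the vertices (labels) of $T_{n,p}$. For a real random variable $X$ and $t\in\mathbb R$, $T_{n;X,t}$ is the random graph on $[n]$ obtained by taking i.i.d. copies $X_1,\dots,X_n$ of $X$ and joining distinct $i,j$ by an edge iff $X_i+X_j>t$. *)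

(* Defs.v *)
From HB Require Import structures.
From mathcomp Require Import all_boot all_order all_algebra all_fingroup.
From mathcomp Require Import all_classical all_reals all_analysis.

Set Implicit Arguments.
Unset Strict Implicit.
Unset Printing Implicit Defensive.

Import Order.TTheory GRing.Theory Num.Theory.

Local Open Scope classical_set_scope.
Local Open Scope ring_scope.

(* The adjacency relation is stored as a finite function, so that Leibniz
   equality of labelled graphs is equality of edge sets. *)
Definition simple_adj (V : finType) (e : {ffun V * V -> bool}) : bool :=
  [forall x, forall y, e (x, y) == e (y, x)] && [forall x, ~~ e (x, x)].

Record sgraph (V : finType) :=
  SGraph { adj_ffun : {ffun V * V -> bool}; _ : simple_adj adj_ffun }.

HB.instance Definition _ (V : finType) := [isSub for @adj_ffun V].
HB.instance Definition _ (V : finType) := [Finite of sgraph V by <:].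

Definition adj (V : finType) (G : sgraph V) : rel V :=
  fun x y => adj_ffun G (x, y).

Lemma adj_sym (V : finType) (G : sgraph V) : symmetric (adj G).
Proof.
case/andP: (valP G) => /forallP es _ x y; apply/eqP.
exact: (forallP (es x)).
Qed.

Lemma adj_irr (V : finType) (G : sgraph V) : irreflexive (adj G).
Proof.
by case/andP: (valP G) => _ /forallP ei x; apply/negbTE; exact: ei.
Qed.

Lemma simple_adjP (V : finType) (e : rel V) :
  symmetric e -> irreflexive e -> simple_adj [ffun z => e z.1 z.2].
Proof.
move=> es ei; apply/andP; split; last by apply/forallP => x; rewrite ffunE ei.
by apply/forallP => x; apply/forallP => y; rewrite !ffunE es.
Qed.

Definition mk_sgraph (V : finType) (e : rel V) (es : symmetric e)
  (ei : irreflexive e) : sgraph V := SGraph (simple_adjP es ei).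

Lemma adj_mk (V : finType) (e : rel V) (es : symmetric e) (ei : irreflexive e) :
  adj (mk_sgraph es ei) =2 e.
Proof. by move=> x y; rewrite /adj ffunE. Qed.

Lemma empty_rel_sym (V : finType) : symmetric ([rel _ _ | false] : rel V).
Proof. by []. Qed.
Lemma empty_rel_irr (V : finType) : irreflexive ([rel _ _ | false] : rel V).
Proof. by []. Qed.

Definition edgeless (V : finType) : sgraph V :=
  mk_sgraph (@empty_rel_sym V) (@empty_rel_irr V).

(* The new vertex is [ord_max]; the old vertices are the [lift ord_max i]. *)
Definition add_vertex_rel (n : nat) (dominating : bool) (G : sgraph 'I_n) :
    rel 'I_n.+1 := fun i j =>
  match unlift ord_max i, unlift ord_max j with
  | Some i', Some j' => adj G i' j'
  | None, None => false
  | _, _ => dominating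
  end.

Lemma add_vertex_sym (n : nat) (b : bool) (G : sgraph 'I_n) :
  symmetric (add_vertex_rel b G).
Proof.
move=> i j; rewrite /add_vertex_rel.
by case: (unlift _ i) => [i'|]; case: (unlift _ j) => [j'|] //; exact: adj_sym.
Qed.

Lemma add_vertex_irr (n : nat) (b : bool) (G : sgraph 'I_n) :
  irreflexive (add_vertex_rel b G).
Proof.
by move=> i; rewrite /add_vertex_rel; case: (unlift _ i) => // i'; exact: adj_irr.
Qed.

Definition add_vertex (n : nat) (dominating : bool) (G : sgraph 'I_n) :
  sgraph 'I_n.+1 := mk_sgraph (add_vertex_sym dominating G)
                              (add_vertex_irr dominating G).

(* Start with a single vertex and make n additions; the k-th added vertex is
   dominating if b k and isolated otherwise.  The result has n.+1 vertices. *)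
Fixpoint grow (n : nat) : ('I_n -> bool) -> sgraph 'I_n.+1 :=
  match n with
  | 0 => fun=> edgeless _
  | m.+1 => fun b => add_vertex (b ord_max) (grow (fun k => b (lift ord_max k)))
  end.

(* The vertex x of G receives the label s x. *)
Definition relabel_rel (V : finType) (s : {perm V}) (G : sgraph V) : rel V :=
  fun x y => adj G ((s^-1)%g x) ((s^-1)%g y).

Lemma relabel_sym (V : finType) (s : {perm V}) (G : sgraph V) :
  symmetric (relabel_rel s G).
Proof. by move=> x y; exact: adj_sym. Qed.

Lemma relabel_irr (V : finType) (s : {perm V}) (G : sgraph V) :
  irreflexive (relabel_rel s G).
Proof. by move=> x; exact: adj_irr. Qed.

Definition relabel (V : finType) (s : {perm V}) (G : sgraph V) : sgraph V :=
  mk_sgraph (relabel_sym s G) (relabel_irr s G).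

Definition weight_rel (R : realType) (V : finType) (t : R) (x : V -> R) :
  rel V := fun i j => (i != j) && (x i + x j > t).

Lemma weight_sym (R : realType) (V : finType) (t : R) (x : V -> R) :
  symmetric (weight_rel t x).
Proof. by move=> i j; rewrite /weight_rel eq_sym addrC. Qed.

Lemma weight_irr (R : realType) (V : finType) (t : R) (x : V -> R) :
  irreflexive (weight_rel t x).
Proof. by move=> i; rewrite /weight_rel eqxx. Qed.

Definition weight_graph (R : realType) (V : finType) (t : R) (x : V -> R) :
  sgraph V := mk_sgraph (weight_sym t x) (weight_irr t x).

HB.instance Definition _ (V : finType) := isPointed.Build (sgraph V) (edgeless V).
HB.instance Definition _ (V : finType) :=
  @isMeasurable.Build default_measure_display (sgraph V) discrete_measurable
    discrete_measurable0 discrete_measurableC discrete_measurableU.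

HB.instance Definition _ (V : finType) := isPointed.Build (perm_type V) (1%g : {perm V}).
HB.instance Definition _ (V : finType) :=
  @isMeasurable.Build default_measure_display (perm_type V) discrete_measurable
    discrete_measurable0 discrete_measurableC discrete_measurableU.

Definition eq_in_distribution (R : realType) (d1 d2 d' : measure_display)
    (O1 : measurableType d1) (O2 : measurableType d2) (T : measurableType d')
    (P1 : probability O1 R) (P2 : probability O2 R)
    (X : {RV P1 >-> T}) (Y : {RV P2 >-> T}) : Prop :=
  forall A : set T, measurable A -> distribution P1 X A = distribution P2 Y A.

Definition mutually_independent (R : realType) (d d' : measure_display)
    (O : measurableType d) (T : measurableType d') (P : probability O R)
    (I : finType) (X : I -> {RV P >-> T}) : Prop :=
  forall (J : {set I}) (A : I -> set T), (forall i, measurable (A i)) ->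
  P (\bigcap_(i in [set` J]) (X i @^-1` A i)) =
  (\big[*%E/1]_(i in J) P (X i @^-1` A i))%E.

Definition independent_pair (R : realType) (d d1 d2 : measure_display)
    (O : measurableType d) (T1 : measurableType d1) (T2 : measurableType d2)
    (P : probability O R) (X : {RV P >-> T1}) (Y : {RV P >-> T2}) : Prop :=
  forall (A : set T1) (B : set T2), measurable A -> measurable B ->
  P (X @^-1` A `&` Y @^-1` B) = (P (X @^-1` A) * P (Y @^-1` B))%E.

Definition has_density (R : realType) (d : measure_display)
    (O : measurableType d) (P : probability O R) (X : {RV P >-> R})
    (f : R -> R) : Prop :=
  [/\ measurable_fun setT f, (forall x, 0 <= f x) &
   forall A : set R, measurable A ->
     distribution P X A = (\int[lebesgue_measure]_(x in A) (f x)%:E)%E].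

Definition iid_copies (R : realType) (d0 d : measure_display)
    (O0 : measurableType d0) (O : measurableType d)
    (P0 : probability O0 R) (P : probability O R)
    (X : {RV P0 >-> R}) (I : finType) (Xs : I -> {RV P >-> R}) : Prop :=
  mutually_independent Xs /\ forall i, eq_in_distribution (Xs i) X.

(* T_{n+1,p}, in the order of addition of its vertices.  This predicate and the
   ones below say that a random graph on an arbitrary probability space arises
   from the construction; existence of such a space is not asserted. *)
Definition is_random_threshold_graph (R : realType) (d : measure_display)
    (O : measurableType d) (P : probability O R) (n : nat) (p : R)
    (T : {RV P >-> sgraph 'I_n.+1}) : Prop :=
  exists B : 'I_n -> {RV P >-> bool},
    [/\ mutually_independent B,
        (forall k, P (B k @^-1` [set true]) = p%:E) &
        forall w, T w = grow (fun k => B k w)].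

Definition is_uniform_perm (R : realType) (d : measure_display)
    (O : measurableType d) (P : probability O R) (V : finType)
    (s : {RV P >-> {perm V}}) : Prop :=
  forall u : {perm V}, P (s @^-1` [set u]) = (#|{: {perm V}}|%:R^-1)%:E.

(* \hat T_{n+1,p}: the permutation is independent of the graph it relabels. *)
Definition is_labelled_random_threshold_graph (R : realType)
    (d : measure_display) (O : measurableType d) (P : probability O R)
    (n : nat) (p : R) (That : {RV P >-> sgraph 'I_n.+1}) : Prop :=
  exists (T : {RV P >-> sgraph 'I_n.+1}) (s : {RV P >-> {perm 'I_n.+1}}),
    [/\ is_random_threshold_graph p T, is_uniform_perm s, independent_pair s T &
        forall w, That w = relabel (s w) (T w)].

(* T_{n;X,t} *)
Definition is_random_weight_graph (R : realType) (d0 d : measure_display)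
    (O0 : measurableType d0) (O : measurableType d)
    (P0 : probability O0 R) (P : probability O R) (n : nat)
    (X : {RV P0 >-> R}) (t : R) (G : {RV P >-> sgraph 'I_n}) : Prop :=
  exists Xs : 'I_n -> {RV P >-> R},
    iid_copies X Xs /\ forall w, G w = weight_graph t (fun i => Xs i w).

Definition two_piece_density (R : realType) (p : R) : R -> R := fun x =>
  if -1 < x < 0 then 1 - p else if 0 < x < 1 then p else 0.

(* Main.v *)
Require Import Defs.
From mathcomp Require Import all_boot all_order all_algebra all_fingroup.
From mathcomp Require Import all_classical all_reals all_analysis.
From mathcomp Require Import ring lra.

(** The weights [X_i] sort the vertices by absolute value.  If [`|x| < `|y|]
then [x + y] has the sign of [y], so every vertex is joined to all or to none of
the vertices preceding it in this order, according to the sign of its weight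
([weight_graph_sorted]).  For the given density the sign of [X] is independent
of [`|X|], which is uniform on (0,1): hence the order is a uniformly random
permutation, independent of the signs, which are independent coins.  This is
the description of the relabelled random threshold graph.

Independence is only given as a product rule for events, so the order and the
signs are read off from a grid instead of a product measure.  Cut (0,1) into
[N] slabs of equal length.  A strictly increasing choice of slabs, a permutation
[u] and a sign vector [b] determine the event that [`|X_(u i)|] lies in the
[i]-th chosen slab and that the signs along [u] are [b]; its probability is a
product ([grid_event_prob]), the graph is constant on it ([grid_event_graph]),
and these events are pairwise disjoint, the permutation being recovered from the
order of the absolute values ([sorting_perm_unique]).

With [m] vertices there are ['C(N, m)] choices of slabs, so these events capture
the fraction [N ^_ m / N ^ m] of the expected law, the loss being the
probability that two weights fall in one slab; letting [N] grow gives a lower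
bound by [threshold_law] for every set of graphs.  Since [threshold_law] has
total mass 1, a lower bound on a set and on its complement is an equality
([law_eq_of_le]).  The same principle identifies the law of the relabelled
graph. *)

Set Implicit Arguments.
Unset Strict Implicit.
Unset Printing Implicit Defensive.

Import Order.TTheory GRing.Theory Num.Theory.

Local Open Scope classical_set_scope.
Local Open Scope ring_scope.

(** * Threshold graphs and the order of the absolute weights *)

Lemma sgraph_eq (V : finType) (G H : sgraph V) : adj G =2 adj H -> G = H.
Proof. by move=> GH; apply: val_inj; apply/ffunP => -[x y]; exact: GH. Qed.

(** The [k]-th added vertex is vertex [k.+1]; indexing the decisions by vertices,
with a dummy one for the initial vertex, removes this shift. *)
Lemma adj_grow (n : nat) (c : 'I_n.+1 -> bool) (i j : 'I_n.+1) :
  (i < j)%N -> adj (grow (fun k => c (lift ord0 k))) i j = c j.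
Proof.
elim: n c i j => [|n IH] c i j; first by rewrite (ord1 i) (ord1 j).
rewrite [grow _]/= => ij; rewrite /add_vertex adj_mk /add_vertex_rel.
case: (unliftP ord_max j) => [j'|] jE; last first.
  subst j; case: unliftP ij => [i' _ _|->]; last by rewrite ltnn.
  by congr c; apply: val_inj.
have ltlift (k : 'I_n.+1) : lift ord_max k = k :> nat by exact: lift_max.
case: (unliftP ord_max i) => [i'|] iE; last first.
  by move: ij; rewrite iE jE ltlift ltnNge /= ltnW.
rewrite jE -(IH (fun k => c (lift ord_max k)) i' j'); last first.
  by move: ij; rewrite iE jE !ltlift.
congr (adj (grow _) _ _); apply/funext => k; congr c; apply: val_inj.
by rewrite /= /bump !leq0n !add1n ltnS !(leqNgt n) ltn_ord.
Qed.

(** In the order of increasing absolute values, the sign of a sum of two weights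
is the sign of the later one. *)
Lemma weight_graph_sorted (R : realType) (n : nat) (x : 'I_n.+1 -> R)
    (u : {perm 'I_n.+1}) :
  (forall i j : 'I_n.+1, (i < j)%N -> `|x (u i)| < `|x (u j)|) ->
  weight_graph 0 x = relabel u (grow (fun k => 0 < x (u (lift ord0 k)))).
Proof.
move=> xu; apply: sgraph_eq => a b; rewrite !adj_mk /relabel_rel /weight_rel.
rewrite -{1 2}[a](permKV u) -{1 2}[b](permKV u).
move: (u^-1 a)%g (u^-1 b)%g => i j; rewrite (inj_eq perm_inj).
wlog ij : i j / (i < j)%N => [sym|].
  case: (ltngtP i j) => [|ji|/val_inj ->]; first exact: sym.
    by rewrite adj_sym -sym// eq_sym addrC.
  by rewrite eqxx adj_irr.
have := xu _ _ ij; rewrite (adj_grow (fun k => 0 < x (u k)) ij).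
have -> /= : i != j by rewrite -val_eqE/= neq_ltn ij.
set s := x _; set t := x _; case: (ltrP 0 t) => t0 st.
  by move: st; rewrite (gtr0_norm t0) ltr_norml; lra.
by apply/negbTE; move: st; rewrite (ler0_norm t0) ltr_norml; lra.
Qed.

(** [y \o u] and [y \o v] enumerate the same values in increasing order, so they
agree, and [y] is injective. *)
Lemma sorting_perm_unique (R : realType) (n : nat) (y : 'I_n -> R)
    (u v : {perm 'I_n}) :
  (forall i j : 'I_n, (i < j)%N -> y (u i) < y (u j)) ->
  (forall i j : 'I_n, (i < j)%N -> y (v i) < y (v j)) ->
  u = v.
Proof.
have tr : transitive (fun i j : 'I_n => (i < j)%N) by move=> ? ? ?; exact: ltn_trans.
have srt (w : {perm 'I_n}) : (forall i j : 'I_n, (i < j)%N -> y (w i) < y (w j)) ->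
    sorted <%R [seq y (w i) | i <- enum 'I_n].
  move=> yw; apply: (homo_sorted (f := fun i => y (w i))
    (e := fun i j : 'I_n => (i < j)%N)) => //.
  by have := iota_ltn_sorted 0 n; rewrite -val_enum_ord sorted_map.
move=> yu yv.
have perm_w (w : {perm 'I_n}) : perm_eq [seq w i | i <- enum 'I_n] (enum 'I_n).
  apply: uniq_perm; [|exact: enum_uniq|].
    by rewrite (map_inj_uniq perm_inj) enum_uniq.
  move=> k; rewrite mem_enum; apply/mapP; exists (w^-1 k)%g; rewrite ?mem_enum//.
  by rewrite permKV.
have E : [seq y (u i) | i <- enum 'I_n] = [seq y (v i) | i <- enum 'I_n].
  apply: lt_sorted_eq; [exact: srt|exact: srt|].
  apply: perm_mem; rewrite (map_comp y u) (map_comp y v) perm_map//.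
  by rewrite (perm_trans (perm_w u))// perm_sym perm_w.
apply/permP => i.
have yinj : injective y.
  move=> a b; rewrite -[a](permKV u) -[b](permKV u).
  move: (_ a) (_ b) => {}a {}b yab; congr (u _); apply: val_inj.
  by case: (ltngtP a b) => // /yu; rewrite yab ltxx.
by apply: yinj; move/eq_in_map : E => /(_ i); apply; rewrite mem_enum.
Qed.

(** * Slabs, signs and their probabilities *)

Lemma sum_disjoint_le (R : realType) (d : measure_display) (T : measurableType d)
    (P : {measure set T -> \bar R}) (I : finType) (Q : pred I) (E : I -> set T)
    (F : set T) :
  measurable F -> (forall i, measurable (E i)) ->
  (forall i, Q i -> E i `<=` F) -> (forall i j x, E i x -> E j x -> i = j) ->
  (\sum_(i | Q i) P (E i) <= P F)%E.
Proof.
move=> mF mE EF Edisj.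
(* Reindexing by ordinals, so that finite additivity applies. *)
rewrite -(eq_bigl _ _ (fun i => erefl : (i \in Q) = Q i)) big_enum_val/=.
rewrite -(measure_semi_additive_ord P); last 1 first.
- exact: bigsetU_measurable.
- rewrite le_measure ?inE//; first exact: bigsetU_measurable.
  rewrite -bigcup_seq => x [k _]; apply: EF; exact: (enum_valP k).
- by move=> k; exact: mE.
- apply/trivIsetP => i j _ _ ij; apply/seteqP; split=> // x [/= xi xj].
  by move: ij; rewrite (enum_val_inj (Edisj _ _ _ xi xj)) eqxx.
Qed.

Definition coin (R : realType) (p : R) (b : bool) : R := if b then p else 1 - p.

Definition coins (R : realType) (p : R) (n : nat) (b : {ffun 'I_n -> bool}) : R :=
  \prod_k coin p (b k).

Lemma coins_total (R : realType) (p : R) (n : nat) : \sum_b @coins R p n b = 1.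
Proof.
rewrite /coins -(bigA_distr_bigA (fun _ b => coin p b)) big1// => k _.
by rewrite big_bool /coin/= addrC subrK.
Qed.

Definition slab (R : realType) (N k : nat) : set R :=
  [set x | k%:R < N%:R * `|x| < k.+1%:R].

Definition half_line (R : realType) (b : bool) : set R := [set x | (0 < x) = b].

(** The strict inequalities defining a slab exclude [0], so within a slab the
complement of the positive half-line is the negative one. *)
Lemma slab_half_lineE (R : realType) (N k : nat) (b : bool) : (k < N)%N ->
  @slab R N k `&` @half_line R b =
  if b then `]k%:R / N%:R, k.+1%:R / N%:R[%classic
  else `](- k.+1%:R / N%:R), (- k%:R / N%:R)[%classic.
Proof.
move=> kN; have N0 : 0 < N%:R :> R by rewrite ltr0n (leq_ltn_trans _ kN).
have k0 : 0 <= k%:R :> R by [].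
apply/seteqP; split=> x; case: b; rewrite /slab /half_line /= in_itv/=.
- move=> [+ x0]; rewrite gtr0_norm//.
  by rewrite ltr_pdivrMr// ltr_pdivlMr// mulrC.
- move=> [+ /negbT]; rewrite -leNgt => + x0; rewrite ler0_norm//.
  rewrite ltr_pdivrMr// ltr_pdivlMr// => /andP[? ?]; lra.
- rewrite ltr_pdivrMr// ltr_pdivlMr// => /andP[xk xk1].
  have x0 : 0 < x by rewrite -(pmulr_lgt0 _ N0); lra.
  by rewrite gtr0_norm// mulrC xk xk1.
- rewrite ltr_pdivrMr// ltr_pdivlMr// => /andP[xk xk1].
  have x0 : x < 0 by rewrite -(pmulr_llt0 _ N0); lra.
  rewrite ltr0_norm//; split; first by apply/andP; split; lra.
  by apply/negbTE; rewrite -leNgt ltW.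
Qed.

Lemma measurable_slab_half_line (R : realType) (N k : nat) (b : bool) : (k < N)%N ->
  measurable (@slab R N k `&` @half_line R b).
Proof. by move=> kN; rewrite slab_half_lineE//; case: b. Qed.

(** The absolute value of [X] is uniform on (0,1) and independent of its sign:
on each of the two intervals the density is constant. *)
Lemma density_slab_half_line (R : realType) (p : R) (d : measure_display)
    (O : measurableType d) (P : probability O R) (X : {RV P >-> R}) (N k : nat)
    (b : bool) :
  has_density X (two_piece_density p) -> (k < N)%N ->
  distribution P X (@slab R N k `&` @half_line R b) = (coin p b / N%:R)%:E.
Proof.
move=> [_ _ Xd] kN; rewrite Xd; last exact: measurable_slab_half_line.
have N0 : 0 < N%:R :> R by rewrite ltr0n (leq_ltn_trans _ kN).
have kN1 : k.+1%:R / N%:R <= 1 :> R by rewrite ler_pdivrMr// mul1r ler_nat.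
have k0 : 0 <= k%:R / N%:R :> R by rewrite divr_ge0.
have kk1 : k%:R / N%:R < k.+1%:R / N%:R :> R by rewrite ltr_pM2r ?invr_gt0// ltr_nat.
under eq_integral => x.
  rewrite slab_half_lineE// inE => xk.
  have -> : two_piece_density p x = coin p b.
    rewrite /two_piece_density /coin; case: b xk; rewrite /= in_itv/= => /andP[xl xr].
      have -> : (x < 0) = false by apply/negbTE; rewrite -leNgt; lra.
      by rewrite andbF (_ : 0 < x < 1)//; apply/andP; split; lra.
    by rewrite (_ : -1 < x < 0)//; apply/andP; split; lra.
  over.
rewrite integral_cst; last exact: measurable_slab_half_line.
rewrite slab_half_lineE//; case: b => /=; rewrite lebesgue_measure_itv/= lte_fin.
  by rewrite kk1 -EFinD -EFinM -mulrBl -natrB// subSnn div1r.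
rewrite !mulNr ltrN2 kk1 -EFinD -EFinM opprK (addrC (- _)) -mulrBl -natrB// subSnn.
by rewrite div1r.
Qed.

Lemma slab_split_sign (R : realType) (N k : nat) :
  @slab R N k = (slab N k `&` half_line true) `|` (slab N k `&` half_line false).
Proof.
rewrite -setIUr (_ : _ `|` _ = setT) ?setIT//.
by apply/seteqP; split=> // x _; rewrite /half_line /=; case: (0 < x); [left|right].
Qed.

Lemma measurable_slab (R : realType) (N k : nat) : (k < N)%N ->
  measurable (@slab R N k).
Proof.
move=> kN; rewrite slab_split_sign.
by apply: measurableU; exact: measurable_slab_half_line.
Qed.

Lemma density_slab (R : realType) (p : R) (d : measure_display)
    (O : measurableType d) (P : probability O R) (X : {RV P >-> R}) (N k : nat) :
  has_density X (two_piece_density p) -> (k < N)%N ->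
  distribution P X (@slab R N k) = (N%:R^-1)%:E.
Proof.
move=> Xd kN.
rewrite slab_split_sign measureU; [|exact: measurable_slab_half_line..|]; last first.
  by apply/seteqP; split=> // x [[_ +] [_]]; rewrite /half_line /= => ->.
rewrite [X in (X + _)%E](density_slab_half_line true Xd kN).
rewrite [X in (_ + X)%E](density_slab_half_line false Xd kN).
by rewrite -EFinD -mulrDl /coin addrC subrK div1r.
Qed.

(** * The law of the relabelled random threshold graph *)

(** The common law: a uniform permutation relabels the graph grown from
independent coins. *)
Definition threshold_law (R : realType) (p : R) (n : nat)
    (A : set (sgraph 'I_n.+1)) : R :=
  \sum_(c : {perm 'I_n.+1} * {ffun 'I_n -> bool} | relabel c.1 (grow c.2) \in A)
    coins p c.2 / (n.+1)`!%:R.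

Lemma threshold_law_setC (R : realType) (p : R) (n : nat) (A : set (sgraph 'I_n.+1)) :
  threshold_law p A + threshold_law p (~` A) = 1.
Proof.
pose F (c : {perm 'I_n.+1} * {ffun 'I_n -> bool}) := coins p c.2 / (n.+1)`!%:R.
transitivity (\sum_c F c).
  rewrite [RHS](bigID (fun c : _ * {ffun _} => relabel c.1 (grow c.2) \in A))/=.
  congr (_ + _).
  by apply: eq_bigl => c; rewrite in_setC.
rewrite -(pair_bigA _ (fun (u : {perm 'I_n.+1}) b => coins p b / (n.+1)`!%:R))/=.
by rewrite sumr_const -mulr_suml coins_total div1r card_Sn -[LHS]mulr_natr mulVf//.
Qed.

(** Since [threshold_law] has total mass 1, the lower bound on the complement of
[A] is an upper bound on [A]. *)
Lemma law_eq_of_le (R : realType) (p : R) (n : nat) (d : measure_display)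
    (O : measurableType d) (P : probability O R) (Z : {RV P >-> sgraph 'I_n.+1}) :
  (forall A, (threshold_law p A)%:E <= distribution P Z A)%E ->
  forall A, distribution P Z A = (threshold_law p A)%:E.
Proof.
move=> lb A; apply/eqP; rewrite eq_le lb andbT.
have mA : measurable A by [].
have [a aE] : exists a, distribution P Z A = a%:E.
  by apply/EFin_fin_numP; exact: fin_num_measure.
have aEC : distribution P Z (~` A) = (1 - a)%:E.
  by rewrite EFinB -aE; exact: probability_setC.
have := lb (~` A); rewrite aE aEC !lee_fin; have := threshold_law_setC p A; lra.
Qed.

Section labelled.
Variables (R : realType) (p : R) (n : nat) (d : measure_display).
Variables (O : measurableType d) (P : probability O R).

(** The events prescribing all coins are disjoint and their product weights are
given by independence. *)
Lemma threshold_graph_law_le (T : {RV P >-> sgraph 'I_n.+1})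
    (H : set (sgraph 'I_n.+1)) :
  is_random_threshold_graph p T ->
  ((\sum_(b : {ffun 'I_n -> bool} | grow b \in H) coins p b)%:E <= P (T @^-1` H))%E.
Proof.
move=> [B [Bind Bp TB]].
pose E (b : {ffun 'I_n -> bool}) :=
  \bigcap_(k in [set` [set: 'I_n]%SET]) (B k @^-1` [set b k]).
have mE b : measurable (E b).
  by apply: fin_bigcap_measurable => // k _; exact: measurable_funPTI.
have PE b : P (E b) = (coins p b)%:E.
  rewrite [LHS](Bind _ (fun k => [set b k]))// /coins -prodEFin.
  apply: eq_big => [k|k _]; first by rewrite inE.
  case: (b k); first exact: Bp.
  have -> : B k @^-1` [set false] = ~` (B k @^-1` [set true]).
    by apply/seteqP; split => w /=; case: (B k w).
  by rewrite probability_setC ?Bp//; exact: measurable_funPTI.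
rewrite -sumEFin -(eq_bigr _ (fun b _ => PE b)); apply: sum_disjoint_le => //.
- exact: measurable_funPTI.
- move=> b bH w Ew; rewrite /preimage /= TB; move: bH; rewrite inE; congr (H (grow _)).
  by apply/funext => k; rewrite (Ew k)//= inE.
- move=> b c w bw cw; apply/ffunP => k.
  by rewrite -(bw k) ?(cw k)//= inE.
Qed.

(** Conditioning on the permutation: it is only known to be independent of the
graph, not of the coins, so the coins are dealt with afterwards by
[threshold_graph_law_le]. *)
Lemma labelled_threshold_law_le (That : {RV P >-> sgraph 'I_n.+1})
    (A : set (sgraph 'I_n.+1)) :
  is_labelled_random_threshold_graph p That ->
  ((threshold_law p A)%:E <= distribution P That A)%E.
Proof.
move=> [T [s [Tp su sT ThatE]]].
pose H u := [set G | A (relabel u G)].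
pose E u := s @^-1` [set u] `&` T @^-1` (H u).
rewrite /threshold_law -(pair_big_dep xpredT
  (fun (u : {perm 'I_n.+1}) (b : {ffun 'I_n -> bool}) => relabel u (grow b) \in A)
  (fun u b => coins p b / (n.+1)`!%:R))/=.
apply: (@le_trans _ _ (\sum_u P (E u))%E); last first.
  apply: sum_disjoint_le => //.
  - exact: measurable_funPTI.
  - by move=> u; apply: measurableI; exact: measurable_funPTI.
  - by move=> u _ w [/= <- Hw]; rewrite /preimage/= ThatE.
  - by move=> u v w [/= <- _] [/= <- _].
rewrite -sumEFin; apply: lee_sum => u _; rewrite /E sT// su card_Sn.
rewrite -mulr_suml EFinM muleC; apply: lee_wpmul2l; first by rewrite lee_fin.
apply: le_trans (threshold_graph_law_le (H u) Tp).
by rewrite lee_fin (eq_bigl (fun b : {ffun 'I_n -> bool} => grow b \in H u)).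
Qed.

End labelled.

(** * The law of the random weight graph *)

(** A birthday bound: the ratio is the probability that [m] independent uniform
choices among [N] are distinct. *)
Lemma grid_ratio_ge (R : realType) (N m : nat) : (0 < N)%N ->
  1 - m%:R ^+ 2 / N%:R <= (N ^_ m)%:R / N%:R ^+ m :> R.
Proof.
move=> N0; have N0R : 0 < N%:R :> R by rewrite ltr0n.
suff H : (1 - m%:R ^+ 2 / N%:R <= (N ^_ m)%:R / N%:R ^+ m :> R) &&
    ((N ^_ m)%:R / N%:R ^+ m <= 1 :> R).
  by case/andP: H.
elim: m => [|m /andP[IH IH1]]; first by rewrite !expr0n/= ffactn0; lra.
rewrite ffactnSr (exprSr N%:R) natrM invfM mulrACA.
set r := (N ^_ m)%:R / _ in IH IH1 *.
have r0 : 0 <= r by rewrite divr_ge0// exprn_ge0.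
set q := (N - m)%:R / _.
have mN : 0 <= m%:R / N%:R :> R by rewrite divr_ge0.
have q1 : 1 - m%:R / N%:R <= q.
  rewrite /q -[X in X - _](divff (lt0r_neq0 N0R)) -mulrBl ler_pM2r ?invr_gt0//.
  by rewrite lerBlDr -natrD ler_nat addnC -leq_subLR.
have q1' : q <= 1 by rewrite /q ler_pdivrMr// mul1r ler_nat leq_subr.
have q0 : 0 <= q by rewrite divr_ge0.
apply/andP; split; last by rewrite mulr_ile1.
have N1 : 0 <= N%:R^-1 :> R by rewrite invr_ge0.
have -> : m.+1%:R ^+ 2 / N%:R
    = m%:R ^+ 2 / N%:R + (m%:R / N%:R) *+ 2 + N%:R^-1 :> R.
  by rewrite -natr1; field; rewrite lt0r_neq0.
have rq : r * (1 - m%:R / N%:R) <= r * q by rewrite ler_wpM2l.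
have rm : r * (m%:R / N%:R) <= m%:R / N%:R by rewrite ler_piMl.
by rewrite mulrBr mulr1 in rq; lra.
Qed.

Section weights.
Variables (R : realType) (p : R) (n : nat) (d0 d : measure_display).
Variables (O0 : measurableType d0) (O : measurableType d).
Variables (P0 : probability O0 R) (P : probability O R).
Variables (X : {RV P0 >-> R}) (Xs : 'I_n.+1 -> {RV P >-> R}).
Hypotheses (hX : has_density X (two_piece_density p)) (hXs : iid_copies X Xs).

(** The vertex of smallest absolute weight is the initial one, for which no coin
is tossed; its sign is therefore left free. *)
Definition cell N (k : 'I_n.+1 -> 'I_N) (b : {ffun 'I_n -> bool})
    (i : 'I_n.+1) : set R :=
  if unlift ord0 i is Some j then slab N (k i) `&` half_line (b j) else slab N (k i).

(** [u i] is the vertex of rank [i] in the order of the absolute weights, so the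
weight of vertex [i] lies in the cell of rank [u^-1 i]. *)
Definition grid_event N (k : 'I_n.+1 -> 'I_N) (u : {perm 'I_n.+1}) b : set O :=
  \bigcap_(i in [set` [set: 'I_n.+1]%SET]) (Xs i @^-1` cell k b (u^-1 i)%g).

Lemma measurable_cell N (k : 'I_n.+1 -> 'I_N) b i : measurable (cell k b i).
Proof.
rewrite /cell; case: unlift => [j|]; first exact: measurable_slab_half_line.
exact: measurable_slab.
Qed.

Lemma measurable_grid_event N (k : 'I_n.+1 -> 'I_N) u b : measurable (grid_event k u b).
Proof.
apply: fin_bigcap_measurable => // i _; apply: measurable_funPTI.
exact: measurable_cell.
Qed.

Lemma grid_event_prob N (k : 'I_n.+1 -> 'I_N) u b :
  P (grid_event k u b) = (coins p b / N%:R ^+ n.+1)%:E.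
Proof.
have [Xind Xid] := hXs.
rewrite /grid_event Xind; last by move=> i; exact: measurable_cell.
transitivity (\prod_i distribution P0 X (cell k b i))%E.
  rewrite [RHS](reindex_inj (@perm_inj _ (u^-1)%g)).
  apply: eq_big => [i|i _]; first by rewrite inE.
  by rewrite -(Xid i)//; exact: measurable_cell.
rewrite big_ord_recl {1}/cell unlift_none (density_slab hX (ltn_ord _)).
rewrite (eq_bigr (fun j => (coin p (b j) / N%:R)%:E)) => [|j _]; last first.
  by rewrite /cell liftK (density_slab_half_line _ hX (ltn_ord _)).
rewrite prodEFin -EFinM big_split/= prodr_const card_ord -exprVn exprS.
by congr (_%:E); rewrite mulrCA.
Qed.

Lemma cell_slab N (k : 'I_n.+1 -> 'I_N) b i x : cell k b i x -> slab N (k i) x.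
Proof. by rewrite /cell; case: unlift => // j []. Qed.

Lemma grid_event_increasing N (k : 'I_n.+1 -> 'I_N) u b w :
  (forall i j : 'I_n.+1, (i < j)%N -> (k i < k j)%N) -> grid_event k u b w ->
  forall i j : 'I_n.+1, (i < j)%N -> `|Xs (u i) w| < `|Xs (u j) w|.
Proof.
move=> kinc kw i j ij.
have slab_at l : slab N (k l) (Xs (u l) w).
  by have := kw (u l); rewrite /= inE permK => /(_ isT)/cell_slab.
have N0 : 0 < N%:R :> R by rewrite ltr0n (leq_ltn_trans _ (ltn_ord (k i))).
have /andP[_ ik] := slab_at i; have /andP[jk _] := slab_at j.
rewrite -(ltr_pM2l N0) (lt_trans ik)// (le_lt_trans _ jk)// ler_nat.
exact: kinc.
Qed.

Lemma grid_event_sign N (k : 'I_n.+1 -> 'I_N) u b w j :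
  grid_event k u b w -> (0 < Xs (u (lift ord0 j)) w) = b j.
Proof.
move=> /(_ (u (lift ord0 j))); rewrite /= inE permK => /(_ isT).
by rewrite /cell liftK => -[].
Qed.

Lemma grid_event_graph N (k : 'I_n.+1 -> 'I_N) u b w :
  (forall i j : 'I_n.+1, (i < j)%N -> (k i < k j)%N) -> grid_event k u b w ->
  weight_graph 0 (fun i => Xs i w) = relabel u (grow b).
Proof.
move=> kinc kw; rewrite (weight_graph_sorted (grid_event_increasing kinc kw)).
by congr (relabel u (grow _)); apply/funext => j; exact: (grid_event_sign _ kw).
Qed.

Lemma slab_unique (N k l : nat) (x : R) : slab N k x -> slab N l x -> k = l.
Proof.
move=> /andP[kx xk] /andP[lx xl]; apply/eqP; rewrite eqn_leq.
by apply/andP; split; rewrite -ltnS -(ltr_nat R) ?(lt_trans kx xl) ?(lt_trans lx xk).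
Qed.

Lemma sorted_tuple_increasing N (t : n.+1.-tuple 'I_N) :
  sorted ltn (map val t) -> forall i j : 'I_n.+1, (i < j)%N -> (tnth t i < tnth t j)%N.
Proof.
move=> ts i j ij; have x0 : 'I_N := tnth t i.
rewrite !(tnth_nth x0) -!(nth_map x0 0%N val) ?size_tuple//.
by apply: (sorted_ltn_nth ltn_trans) => //; rewrite inE size_map size_tuple.
Qed.

(** The events run over increasing choices of slabs, permutations and signs.
Summing over the ['C(N, n.+1)] choices of slabs turns the factor
[1 / (n.+1)`!] of [threshold_law] into the ratio of the statement. *)
Lemma weight_graph_law_grid_le N (TX : {RV P >-> sgraph 'I_n.+1})
    (A : set (sgraph 'I_n.+1)) :
  (forall w, TX w = weight_graph 0 (fun i => Xs i w)) ->
  ((threshold_law p A * ((N ^_ n.+1)%:R / N%:R ^+ n.+1))%:E <= distribution P TX A)%E.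
Proof.
move=> TXE.
pose S := [set t : n.+1.-tuple 'I_N | sorted ltn (map val t)]%SET.
pose E (c : n.+1.-tuple 'I_N * ({perm 'I_n.+1} * {ffun 'I_n -> bool})) :=
  if c.1 \in S then grid_event (tnth c.1) c.2.1 c.2.2 else set0.
pose Q (c : n.+1.-tuple 'I_N * ({perm 'I_n.+1} * {ffun 'I_n -> bool})) :=
  (c.1 \in S) && (relabel c.2.1 (grow c.2.2) \in A).
apply: (@le_trans _ _ (\sum_(c | Q c) P (E c))%E).
  rewrite /Q -(pair_big (mem S) (fun c : {perm 'I_n.+1} * {ffun 'I_n -> bool} =>
    relabel c.1 (grow c.2) \in A) (fun t c => P (E (t, c))))/=.
  rewrite (eq_bigr (fun=> (\sum_(c : {perm 'I_n.+1} * {ffun 'I_n -> bool} |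
     relabel c.1 (grow c.2) \in A) coins p c.2 / N%:R ^+ n.+1)%:E)); last first.
    move=> t tS; rewrite -sumEFin; apply: eq_bigr => c _.
    by rewrite /E /= tS grid_event_prob.
  rewrite sumEFin lee_fin sumr_const card_ltn_sorted_tuples /threshold_law.
  rewrite -!mulr_suml -mulr_natr -bin_ffact natrM le_eqVlt; apply/orP; left.
  have f0 : (n.+1)`!%:R != 0 :> R by rewrite pnatr_eq0 -lt0n fact_gt0.
  (* [N] may be [0], so the inverse of its power is kept as an atom. *)
  apply/eqP; set s := \sum_(_ | _) _; set q := (N%:R ^+ _)^-1; by field.
apply: sum_disjoint_le.
- exact: measurable_funPTI.
- by move=> c; rewrite /E; case: ifP => // _; exact: measurable_grid_event.
- move=> [t [u b]] /andP[/= tS cA] w; rewrite /E /= tS => Ew.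
  rewrite /preimage /= TXE (grid_event_graph _ Ew); first by rewrite inE in cA.
  by apply: sorted_tuple_increasing; rewrite inE in tS.
- move=> [t [u b]] [t' [u' b']] w; rewrite /E /=.
  case: ifP => // tS Ew; case: ifP => // tS' Ew'.
  rewrite !inE in tS tS'.
  have uE : u = u'.
    apply: (@sorting_perm_unique _ _ (fun i => `|Xs i w|)).
      exact: grid_event_increasing (sorted_tuple_increasing tS) Ew.
    exact: grid_event_increasing (sorted_tuple_increasing tS') Ew'.
  subst u'; congr (_, (_, _)).
    apply: eq_from_tnth => i; apply: val_inj.
    have := Ew (u i); have := Ew' (u i); rewrite /= inE permK.
    move=> /(_ isT)/cell_slab s1 /(_ isT)/cell_slab s2; exact: slab_unique s2 s1.
  by apply/ffunP => j; rewrite -(grid_event_sign j Ew) -(grid_event_sign j Ew').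
Qed.

End weights.

(** The limit of [weight_graph_law_grid_le] as the grid is refined. *)
Lemma weight_threshold_law_le (R : realType) (p : R) (n : nat) (d0 d : measure_display)
    (O0 : measurableType d0) (O : measurableType d)
    (P0 : probability O0 R) (P : probability O R)
    (X : {RV P0 >-> R}) (TX : {RV P >-> sgraph 'I_n.+1}) (A : set (sgraph 'I_n.+1)) :
  0 <= p <= 1 -> has_density X (two_piece_density p) ->
  is_random_weight_graph X 0 TX ->
  ((threshold_law p A)%:E <= distribution P TX A)%E.
Proof.
move=> p01 hX [Xs [hXs TXE]].
have mA : measurable A by [].
have lb N := weight_graph_law_grid_le hX hXs N A TXE.
have [a aE] : exists a, distribution P TX A = a%:E.
  by apply/EFin_fin_numP; exact: fin_num_measure.
rewrite aE lee_fin.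
have l0 (B : set (sgraph 'I_n.+1)) : 0 <= threshold_law p B :> R.
  apply: sumr_ge0 => c _; rewrite divr_ge0// prodr_ge0// => k _.
  by rewrite /coin; case: ifP; lra.
have l1 : threshold_law p A <= 1.
  by have := threshold_law_setC p A; have := l0 (~` A); lra.
apply/ler_addgt0Pr => e e0.
have [N Ne] : exists N, n.+1%:R ^+ 2 / e < N.+1%:R.
  exists (Num.bound (n.+1%:R ^+ 2 / e)).
  by rewrite (lt_trans (archi_boundP _))// ?ltr_nat// divr_ge0// ltW.
have {}lb := lb N.+1; rewrite aE lee_fin in lb.
have Ne' : n.+1%:R ^+ 2 / N.+1%:R < e.
  by rewrite ltr_pdivrMr ?ltr0n// mulrC -ltr_pdivrMr.
have ratio := ler_wpM2l (l0 A) (grid_ratio_ge R n.+1 (ltn0Sn N)).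
have err : threshold_law p A * (n.+1%:R ^+ 2 / N.+1%:R) <= n.+1%:R ^+ 2 / N.+1%:R.
  by rewrite ler_piMl// divr_ge0// exprn_ge0.
rewrite mulrBr mulr1 in ratio.
set r := threshold_law p A * (_%:R / _) in lb ratio.
set M := _ / _ in Ne' ratio err; set L := threshold_law p A * M in ratio err.
by lra.
Qed.

Theorem corollary6p6 (R : realType) (p : R) (n : nat)
  (d0 d1 d2 : measure_display)
  (O0 : measurableType d0) (O1 : measurableType d1) (O2 : measurableType d2)
  (P0 : probability O0 R) (P1 : probability O1 R) (P2 : probability O2 R)
  (X : {RV P0 >-> R})
  (That : {RV P1 >-> sgraph 'I_n.+1}) (TX : {RV P2 >-> sgraph 'I_n.+1})
  (hp : 0 <= p <= 1)
  (hX : has_density X (two_piece_density p))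
  (hThat : is_labelled_random_threshold_graph p That)
  (hTX : is_random_weight_graph X 0 TX) :
  eq_in_distribution That TX.
Proof.
move=> A _.
rewrite (law_eq_of_le (fun B => labelled_threshold_law_le B hThat)).
by rewrite (law_eq_of_le (fun B => weight_threshold_law_le B hp hX hTX)).
Qed.
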